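(* Let $\ell>0$ and $\lambda>0$, and consider the difference scheme (S) on the optimal grid, both as defined in the context. Then the finite difference solution of (S) on the optimal grid is stable (in the $\ell_\infty$ sense given in the context) and converges to the exact solution $u(x)=e^{\lambda(x-\ell)}$ with order $\mathcal{O}(h^4)$. That is, there exist a constant $C$ (independent of $N$) and $N_0\in\mathbb{N}$ such that for all $N\ge N_0$, with $h=1/N$, the solution $(u_j)_{j=0}^N$ of (S) on the optimal grid satisfies $$\max_{0\le j\le N}|u_j-u(x_j)|\le C\,h^4 .$$
   Context: Continuous problem: on $[0,\ell]$, $$-u''(x)+\lambda^2u(x)=0,\qquad u(0)=e^{-\lambda\ell},\quad u(\ell)=1,$$ whose exact solution is $u(x)=e^{\lambda(x-\ell)}$. Grid: for $N\in\mathbb{N}$, $N\ge 2$, put $h=1/N$ and $q_j=jh$, $0\le j\le N$. The optimal grid is $x_j=x(q_j)$, where $x:[0,1]\to[0,\ell]$ solves $$\frac{d}{dq}\Bigl[\bigl(u_x(x(q))\bigr)^{1/4}\frac{dx}{dq}\Bigr]=0,\qquad x(0)=0,\ x(1)=\ell,$$ with $u_x$ the derivative of the exact solution $u$; explicitly $$x(q)=\ell+\frac{4}{\lambda}\ln\bigl(q+(1-q)e^{-\lambda\ell/4}\bigr).$$ Notation: $h_{j+1/2}=x_{j+1}-x_j$ for $0\le j\le N-1$ (so $h_{j-1/2}=x_j-x_{j-1}$), and $h_j=\tfrac12(h_{j-1/2}+h_{j+1/2})$ for $1\le j\le N-1$. Difference scheme (S): find $(u_j)_{j=0}^N$ with $$-\frac{1}{h_j}\Bigl[\frac{u_{j+1}-u_j}{h_{j+1/2}}-\frac{u_j-u_{j-1}}{h_{j-1/2}}\Bigr]+\lambda^2u_j=0,\quad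 j=1,\dots,N-1,\qquad u_0=e^{-\lambda\ell},\ u_N=1.$$ Stability: the scheme is called stable (in the $\ell_\infty$ norm) if there is a constant $C_s$, independent of $N$, such that for every $N$ and all real data $\mu_0,\mu_\ell,f_1,\dots,f_{N-1}$, any solution $(u_j)_{j=0}^N$ of $$-\frac{1}{h_j}\Bigl[\frac{u_{j+1}-u_j}{h_{j+1/2}}-\frac{u_j-u_{j-1}}{h_{j-1/2}}\Bigr]+\lambda^2u_j=f_j,\quad j=1,\dots,N-1,\qquad u_0=\mu_0,\ u_N=\mu_\ell,$$ satisfies $$\max_{0\le j\le N}|u_j|\le C_s\max\Bigl\{|\mu_0|,\,|\mu_\ell|,\,\max_{1\le j\le N-1}|f_j|\Bigr\}.$$ *)

(* Defs.v *)
From Stdlib Require Import Reals RList List Lra.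
From Coquelicot Require Import Coquelicot.

Local Open Scope R_scope.

Definition exact_sol (l lam x : R) : R := exp (lam * (x - l)).

Lemma is_derive_exact_sol (l lam x : R) :
  is_derive (exact_sol l lam) x (lam * exact_sol l lam x).
Proof. unfold exact_sol; auto_derive; [easy | unfold Rminus; ring]. Qed.

Lemma exact_sol_bvp (l lam : R) :
  (forall x : R, - Derive_n (exact_sol l lam) 2 x
                 + lam ^ 2 * exact_sol l lam x = 0) /\
  exact_sol l lam 0 = exp (- (lam * l)) /\ exact_sol l lam l = 1.
Proof.
assert (D : forall x, Derive (exact_sol l lam) x = lam * exact_sol l lam x)
  by (intro x; apply is_derive_unique, is_derive_exact_sol).
split; [intro x | split].
- change (Derive_n (exact_sol l lam) 2 x)
    with (Derive (Derive (exact_sol l lam)) x).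
  rewrite (Derive_ext _ _ x D), Derive_scal, D; ring.
- unfold exact_sol; f_equal; ring.
- unfold exact_sol; replace (lam * (l - l)) with 0 by ring; apply exp_0.
Qed.

(** The differential equation is imposed on the open interval, with continuity
    up to the end points: a map of type [R -> R] is unconstrained outside
    [[0, 1]], so its two-sided derivative at 0 or 1 has no meaning. *)
Record optimal_map (l lam : R) (x : R -> R) : Prop := {
  optimal_map_range : forall q, 0 <= q <= 1 -> 0 <= x q <= l;
  optimal_map_cont : continuous_on (fun q => 0 <= q <= 1) x;
  optimal_map_diff : forall q, 0 < q < 1 -> ex_derive x q;
  optimal_map_ode : forall q, 0 < q < 1 ->
    is_derive
      (fun p => Rpower (Derive (exact_sol l lam) (x p)) (1 / 4) * Derive x p)
      q 0;
  optimal_map_0 : x 0 = 0;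
  optimal_map_1 : x 1 = l
}.

Definition optimal_map_explicit (l lam q : R) : R :=
  l + 4 / lam * ln (q + (1 - q) * exp (- (lam * l) / 4)).

Lemma MVT_zero (f : R -> R) (a b : R) :
  (forall q, a < q < b -> is_derive f q 0) ->
  forall p q, a < p < b -> a < q < b -> f p = f q.
Proof.
intros H p q Hp Hq.
assert (B : forall t, Rmin p q <= t <= Rmax p q -> a < t < b).
{ intros t; unfold Rmin, Rmax; destruct (Rle_dec p q); lra. }
destruct (MVT_gen f p q (fun _ => 0)) as [c [_ Hc]].
- intros t Ht; apply H, B; lra.
- intros t Ht; apply continuity_pt_filterlim.
  apply (ex_derive_continuous f t); exists 0; apply H, B, Ht.
- lra.
Qed.

Lemma clamp_bound (q : R) : 0 <= Rmax 0 (Rmin q 1) <= 1.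
Proof. unfold Rmax, Rmin; repeat destruct Rle_dec; lra. Qed.

Lemma clamp_id (q : R) : 0 <= q <= 1 -> Rmax 0 (Rmin q 1) = q.
Proof. unfold Rmax, Rmin; repeat destruct Rle_dec; lra. Qed.

Lemma clamp_continuous (x : R -> R) :
  continuous_on (fun q => 0 <= q <= 1) x ->
  forall q, continuous (fun t => x (Rmax 0 (Rmin t 1))) q.
Proof.
intros H q P HP.
destruct (H _ (clamp_bound q) P HP) as [e He].
exists e; intros y Hy; apply He; [ | apply clamp_bound].
revert Hy; unfold ball; simpl; unfold AbsRing_ball, abs, minus, plus, opp; simpl.
unfold Rmax, Rmin, Rabs; repeat destruct Rle_dec; repeat destruct Rcase_abs; lra.
Qed.

Lemma affine_of_derive (g : R -> R) (c : R) :
  continuous_on (fun q => 0 <= q <= 1) g ->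
  (forall q, 0 < q < 1 -> is_derive g q c) ->
  forall q, 0 <= q <= 1 -> g q = g 0 + c * q.
Proof.
intros Hc Hd q Hq.
destruct (MVT_gen (fun t => g (Rmax 0 (Rmin t 1))) 0 q (fun _ => c))
  as [d [_ E]].
- rewrite Rmin_left, Rmax_right by lra; intros t Ht.
  apply is_derive_ext_loc with g; [ | apply Hd; lra].
  assert (P : 0 < Rmin t (1 - t)) by (apply Rmin_pos; lra).
  exists (mkposreal _ P); intros y Hy; rewrite clamp_id; [easy | revert Hy].
  unfold ball; simpl; unfold AbsRing_ball, abs, minus, plus, opp; simpl.
  unfold Rmin, Rabs; destruct Rle_dec, Rcase_abs; lra.
- intros t _; apply continuity_pt_filterlim, (clamp_continuous g Hc).
- rewrite !clamp_id in E by lra; lra.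
Qed.

Lemma optimal_map_explicit_pos (l lam q : R) :
  0 <= q <= 1 -> 0 < q + (1 - q) * exp (- (lam * l) / 4).
Proof.
intros Hq; pose proof (exp_pos (- (lam * l) / 4)) as He.
destruct (Req_dec q 0) as [-> | ]; [lra | nra].
Qed.

Lemma flux_factor (l lam y : R) : 0 < lam ->
  Rpower (Derive (exact_sol l lam) y) (1 / 4)
  = Rpower lam (1 / 4) * exp (lam * (y - l) / 4).
Proof.
intros Hlam; rewrite (is_derive_unique _ _ _ (is_derive_exact_sol l lam y)).
rewrite <- Rpower_mult_distr by (assumption || apply exp_pos).
f_equal; unfold Rpower, exact_sol; rewrite ln_exp; f_equal; field.
Qed.

Theorem optimal_mapE (l lam : R) (x : R -> R) : 0 < l -> 0 < lam ->
  optimal_map l lam x <->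
  (forall q, 0 <= q <= 1 -> x q = optimal_map_explicit l lam q).
Proof.
intros Hl Hlam; split.
- intros [_ Hc Hd Ho H0 H1].
  set (F := fun p => Rpower (Derive (exact_sol l lam) (x p)) (1 / 4) * Derive x p).
  set (K := Rpower lam (1 / 4)).
  assert (HK : 0 < K) by apply exp_pos.
  set (g := fun q => exp (lam * (x q - l) / 4)).
  set (c := lam / (4 * K) * F (1 / 2)).
  assert (Hg : forall q, 0 <= q <= 1 -> g q = g 0 + c * q).
  { apply affine_of_derive.
    - intros q Hq; unfold g.
      refine (filterlim_comp _ _ _ x (fun y => exp (lam * (y - l) / 4))
                _ _ _ (Hc q Hq) _).
      apply (ex_derive_continuous (fun y => exp (lam * (y - l) / 4))).
      auto_derive; easy.
    - intros q Hq; unfold c.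
      rewrite (MVT_zero F 0 1 Ho (1 / 2) q) by lra.
      unfold F; rewrite (flux_factor l lam (x q) Hlam); fold K; unfold g.
      pose proof (Hd q Hq) as Hdq.
      auto_derive; [easy | ].
      unfold Rminus, Rdiv; change (fun x0 => x x0) with x; field; lra. }
  assert (G0 : g 0 = exp (- (lam * l) / 4)).
  { unfold g; rewrite H0; f_equal; field. }
  assert (G1 : g 1 = 1).
  { unfold g; rewrite H1; replace (lam * (l - l) / 4) with 0 by field.
    apply exp_0. }
  assert (Ec : c = 1 - g 0) by (pose proof (Hg 1 ltac:(lra)); lra).
  intros q Hq; unfold optimal_map_explicit; rewrite <- G0.
  replace (q + (1 - q) * g 0) with (g q) by (rewrite Hg, Ec by easy; ring).
  unfold g; rewrite ln_exp; field; lra.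
- intros Hx.
  assert (Pe := exp_pos (- (lam * l) / 4)).
  assert (Le : exp (- (lam * l) / 4) < 1).
  { rewrite <- exp_0; apply exp_increasing; nra. }
  set (s := fun q => q + (1 - q) * exp (- (lam * l) / 4)).
  assert (Ps : forall q, 0 <= q <= 1 -> 0 < s q)
    by (intro q; apply optimal_map_explicit_pos).
  assert (De : forall q, 0 <= q <= 1 ->
    is_derive (optimal_map_explicit l lam) q
      (4 / lam * ((1 - exp (- (lam * l) / 4)) / s q))).
  { intros q Hq; specialize (Ps q Hq); unfold s, optimal_map_explicit in *.
    auto_derive; [exact Ps | unfold Rminus, Rdiv in *; field; lra]. }
  assert (Loc : forall q, 0 < q < 1 -> locally q (fun t => 0 < t < 1)).
  { intros q Hq; apply filter_and; [apply open_gt | apply open_lt]; lra. }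
  assert (Dx : forall q, 0 < q < 1 ->
    is_derive x q (4 / lam * ((1 - exp (- (lam * l) / 4)) / s q))).
  { intros q Hq; apply is_derive_ext_loc with (optimal_map_explicit l lam).
    - generalize (Loc q Hq); apply filter_imp; intros t Ht.
      symmetry; apply Hx; lra.
    - apply De; lra. }
  split.
  + intros q Hq; rewrite Hx by easy; unfold optimal_map_explicit; fold (s q).
    assert (4 / lam * - (lam * l / 4) <= 4 / lam * ln (s q) <= 4 / lam * 0).
    { assert (0 < 4 / lam) by (apply Rdiv_lt_0_compat; lra).
      split; apply Rmult_le_compat_l; try lra.
      - replace (- (lam * l / 4)) with (ln (exp (- (lam * l) / 4)))
          by (rewrite ln_exp; field).
        apply ln_le; [easy | unfold s; nra].
      - rewrite <- ln_1; apply ln_le; [now apply Ps | unfold s; nra]. }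
    replace (4 / lam * - (lam * l / 4)) with (- l) in * by (field; lra).
    lra.
  + intros q Hq P HP.
    rewrite Hx in HP by easy.
    assert (C : continuous (optimal_map_explicit l lam) q)
      by (apply (ex_derive_continuous (optimal_map_explicit l lam)); eexists; now apply De).
    generalize (C P HP); unfold filtermap, within; apply filter_imp.
    intros t Ht Dt; now rewrite Hx.
  + intros q Hq; eexists; now apply Dx.
  + intros q Hq.
    apply is_derive_ext_loc with
      (fun _ => Rpower lam (1 / 4) * (4 / lam * (1 - exp (- (lam * l) / 4)))).
    * generalize (Loc q Hq); apply filter_imp; intros t Ht.
      rewrite (is_derive_unique _ _ _ (Dx t Ht)), (flux_factor l lam _ Hlam).
      rewrite Hx by lra; unfold optimal_map_explicit; fold (s t).
      pose proof (Ps t ltac:(lra)) as Pt.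
      replace (lam * (l + 4 / lam * ln (s t) - l) / 4) with (ln (s t))
        by (field; lra).
      rewrite exp_ln by easy.
      match goal with |- @eq _ ?a ?b => change (@eq R a b) end; field; lra.
    * auto_derive; easy.
  + rewrite Hx by lra; unfold optimal_map_explicit.
    replace (0 + (1 - 0) * exp (- (lam * l) / 4)) with (exp (- (lam * l) / 4))
      by ring.
    rewrite ln_exp; field; lra.
  + rewrite Hx by lra; unfold optimal_map_explicit.
    replace (1 + (1 - 1) * exp (- (lam * l) / 4)) with 1 by ring.
    rewrite ln_1; ring.
Qed.

Definition mesh (N : nat) : R := 1 / INR N.

(** [image_grid x N j] is the node of index [j], for [0 <= j <= N]. *)
Definition image_grid (x : R -> R) (N j : nat) : R := x (INR j * mesh N).

(** [half_step X j] is the step between nodes [j] and [j + 1]; [mid_step X j]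
    is the averaged step at an interior node [j], for [j >= 1]. *)
Definition half_step (X : nat -> R) (j : nat) : R := X (j + 1)%nat - X j.

Definition mid_step (X : nat -> R) (j : nat) : R :=
  1 / 2 * (half_step X (j - 1) + half_step X j).

Definition scheme_op (lam : R) (X u : nat -> R) (j : nat) : R :=
  - (1 / mid_step X j) *
    ((u (j + 1)%nat - u j) / half_step X j
     - (u j - u (j - 1)%nat) / half_step X (j - 1))
  + lam ^ 2 * u j.

(** Grid functions have type [nat -> R]; only their values at the indices
    [0, ..., N] matter, and only the values of [f] at [1, ..., N - 1]. *)
Definition scheme_solution (lam : R) (N : nat) (X : nat -> R)
    (mu0 mul : R) (f u : nat -> R) : Prop :=
  (forall j, (1 <= j <= N - 1)%nat -> scheme_op lam X u j = f j) /\
  u 0%nat = mu0 /\ u N = mul.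

(** The maximum of [|v j|] over [a <= j < a + n], for [n >= 1]. *)
Definition max_abs (v : nat -> R) (a n : nat) : R :=
  MaxRlist (map (fun j => Rabs (v j)) (seq a n)).

Definition stable (lam : R) (X : nat -> nat -> R) : Prop :=
  exists Cs : R, forall N : nat, (2 <= N)%nat ->
    forall (mu0 mul : R) (f u : nat -> R),
      scheme_solution lam N (X N) mu0 mul f u ->
      max_abs u 0 (N + 1) <=
        Cs * Rmax (Rabs mu0) (Rmax (Rabs mul) (max_abs f 1 (N - 1))).

Definition optimal_scheme_solution (l lam : R) (x : R -> R) (N : nat)
    (u : nat -> R) : Prop :=
  scheme_solution lam N (image_grid x N) (exp (- (lam * l))) 1 (fun _ => 0) u.

(* Main.v *)
(** Stability is the discrete maximum principle: at an interior maximum the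
    difference quotient has a sign, so that [lam ^ 2 * u j <= f j].  On the
    optimal grid the exact solution at the nodes is [s j ^ 4] and the steps are
    [4 / lam * ln (s (j + 1) / s j)], with [s j] an arithmetic progression of
    difference [d <= h].  The truncation error is then [lam ^ 2 * s j ^ 4] times
    a function of [t = d / s j] that is [O(t ^ 4)], hence [O(d ^ 4)] uniformly
    in [j], and stability turns this into the error bound. *)
Require Import Defs.
From Stdlib Require Import Reals RList List Lra Lia.
From Coquelicot Require Import Coquelicot.
Local Open Scope R_scope.

(** * Maxima of grid functions *)

(** The maximum of a nonempty list is one of its entries, so it inherits their bound. For [n = 0]
    the list is empty and [MaxRlist] takes the default value 0. *)
Lemma max_abs_le (v : nat -> R) (a n : nat) (B : R) : (1 <= n)%nat ->
  (forall j, (a <= j < a + n)%nat -> Rabs (v j) <= B) -> max_abs v a n <= B.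
Proof.
intros Hn H; unfold max_abs.
assert (I : In (MaxRlist (map (fun j => Rabs (v j)) (seq a n)))
                (map (fun j => Rabs (v j)) (seq a n))).
{ apply MaxRlist_P2; exists (Rabs (v a)).
  apply (in_map (fun j => Rabs (v j))), in_seq; lia. }
apply in_map_iff in I; destruct I as [j [E Hj]].
rewrite <- E; apply H; now apply in_seq.
Qed.

Lemma le_max_abs (v : nat -> R) (a n j : nat) :
  (a <= j < a + n)%nat -> Rabs (v j) <= max_abs v a n.
Proof.
intros Hj; apply MaxRlist_P1.
apply (in_map (fun j => Rabs (v j))), in_seq; lia.
Qed.

Lemma exists_argmax (u : nat -> R) (N : nat) :
  exists k, (k <= N)%nat /\ forall j, (j <= N)%nat -> u j <= u k.
Proof.
induction N as [ | N [k [Hk H]]].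
- exists 0%nat; split; [easy | intros j Hj].
  replace j with 0%nat by lia; lra.
- destruct (Rle_dec (u (S N)) (u k)) as [L | L].
  + exists k; split; [lia | intros j Hj].
    destruct (Nat.eq_dec j (S N)) as [-> | ]; [easy | apply H; lia].
  + exists (S N); split; [lia | intros j Hj].
    destruct (Nat.eq_dec j (S N)) as [-> | ]; [lra | ].
    apply Rle_trans with (u k); [apply H; lia | lra].
Qed.

(** * Discrete maximum principle and stability *)

Definition increasing_grid (N : nat) (X : nat -> R) : Prop :=
  forall j, (j < N)%nat -> 0 < half_step X j.

Lemma mid_step_pos (N : nat) (X : nat -> R) (j : nat) :
  increasing_grid N X -> (1 <= j <= N - 1)%nat -> 0 < mid_step X j.
Proof.
intros HX Hj; unfold mid_step.
pose proof (HX (j - 1)%nat ltac:(lia)); pose proof (HX j ltac:(lia)); lra.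
Qed.

Lemma scheme_op_plus_scal (lam c : R) (X u v : nat -> R) (j : nat) :
  scheme_op lam X (fun i => u i + c * v i) j
  = scheme_op lam X u j + c * scheme_op lam X v j.
Proof. unfold scheme_op, Rdiv; ring. Qed.

Lemma scheme_op_opp (lam : R) (X u : nat -> R) (j : nat) :
  scheme_op lam X (fun i => - u i) j = - scheme_op lam X u j.
Proof. unfold scheme_op, Rdiv; ring. Qed.

Lemma scheme_op_minus (lam : R) (X u v : nat -> R) (j : nat) :
  scheme_op lam X (fun i => u i - v i) j
  = scheme_op lam X u j - scheme_op lam X v j.
Proof. unfold scheme_op, Rdiv; ring. Qed.

(** Comparison with the constant grid function [M], on which the operator equals [lam ^ 2 * M]. The
    bound is one-sided; lower bounds come from applying it to [- u]. *)
Lemma scheme_max_principle (lam M : R) (N : nat) (X u : nat -> R) :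
  0 < lam -> increasing_grid N X -> u 0%nat <= M -> u N <= M ->
  (forall j, (1 <= j <= N - 1)%nat -> scheme_op lam X u j <= lam ^ 2 * M) ->
  forall j, (j <= N)%nat -> u j <= M.
Proof.
intros Hlam HX H0 HN Hop.
destruct (exists_argmax u N) as [k [Hk Hmax]].
enough (u k <= M) by (intros j Hj; specialize (Hmax j Hj); lra).
destruct (Nat.eq_dec k 0) as [-> | K0]; [easy | ].
destruct (Nat.eq_dec k N) as [-> | KN]; [easy | ].
assert (Hk' : (1 <= k <= N - 1)%nat) by lia.
specialize (Hop k Hk'); unfold scheme_op in Hop.
pose proof (mid_step_pos N X k HX Hk') as Pm.
pose proof (HX (k - 1)%nat ltac:(lia)) as P1.
pose proof (HX k ltac:(lia)) as P2.
pose proof (Hmax (k + 1)%nat ltac:(lia)) as M2.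
pose proof (Hmax (k - 1)%nat ltac:(lia)) as M1.
apply Rinv_0_lt_compat in Pm, P1, P2.
assert (0 < lam ^ 2) by (apply pow_lt; easy).
unfold Rdiv in Hop.
assert (A1 : (u (k + 1)%nat - u k) * / half_step X k <= 0) by nra.
assert (A2 : 0 <= (u k - u (k - 1)%nat) * / half_step X (k - 1)) by nra.
apply Rmult_le_reg_l with (lam ^ 2); [easy | nra].
Qed.

(** With [M] this constant times a bound [m] on the data, the entry 1 gives [m <= M] for the
    boundary values and [/ lam ^ 2] gives [m <= lam ^ 2 * M] for the source. *)
Definition stability_constant (lam : R) : R := Rmax 1 (/ lam ^ 2).

Lemma scheme_stability (lam m mu0 mul : R) (N : nat) (X f u : nat -> R) :
  0 < lam -> increasing_grid N X -> scheme_solution lam N X mu0 mul f u ->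
  0 <= m -> Rabs mu0 <= m -> Rabs mul <= m ->
  (forall j, (1 <= j <= N - 1)%nat -> Rabs (f j) <= m) ->
  forall j, (j <= N)%nat -> Rabs (u j) <= stability_constant lam * m.
Proof.
intros Hlam HX [Hu [H0 HN]] Hm B0 BN Bf.
assert (P : 0 < lam ^ 2) by (apply pow_lt; easy).
set (M := stability_constant lam * m).
assert (M1 : m <= M).
{ pose proof (Rmax_l 1 (/ lam ^ 2)); unfold M, stability_constant; nra. }
assert (M2 : m <= lam ^ 2 * M).
{ pose proof (Rmax_r 1 (/ lam ^ 2)) as L; unfold M, stability_constant.
  apply Rmult_le_compat_l with (r := lam ^ 2) in L; [ | lra].
  rewrite Rinv_r in L by lra; nra. }
apply Rabs_le_between in B0, BN.
intros j Hj; apply Rabs_le; split.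
- enough (- u j <= M) by lra.
  apply (scheme_max_principle lam M N X (fun i => - u i)); try easy; try lra.
  intros i Hi; rewrite scheme_op_opp, Hu by easy.
  specialize (Bf i Hi); apply Rabs_le_between in Bf; lra.
- apply (scheme_max_principle lam M N X u); try easy; try lra.
  intros i Hi; rewrite Hu by easy.
  specialize (Bf i Hi); apply Rabs_le_between in Bf; lra.
Qed.

Lemma stable_of_increasing (lam : R) (X : nat -> nat -> R) : 0 < lam ->
  (forall N, (2 <= N)%nat -> increasing_grid N (X N)) -> stable lam X.
Proof.
intros Hlam HX; exists (stability_constant lam); intros N HN mu0 mul f u Hu.
set (m := Rmax (Rabs mu0) (Rmax (Rabs mul) (max_abs f 1 (N - 1)))).
assert (B0 : Rabs mu0 <= m) by apply Rmax_l.
apply max_abs_le; [lia | intros j Hj].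
apply (scheme_stability lam m mu0 mul N (X N) f u); auto; try lia.
- pose proof (Rabs_pos mu0); lra.
- eapply Rle_trans; [apply Rmax_l | apply Rmax_r].
- intros i Hi; eapply Rle_trans; [apply (le_max_abs f 1 (N - 1)); lia | ].
  eapply Rle_trans; apply Rmax_r.
Qed.

(** * Existence of a discrete solution by shooting *)

(** The pair holds the values at nodes [j] and [j + 1], starting from [a] and [b] at nodes 0 and 1.
    Each step solves the scheme equation at node [j] for the value at [j + 1]. *)
Fixpoint march (lam : R) (X f : nat -> R) (a b : R) (j : nat) : R * R :=
  match j with
  | O => (a, b)
  | S i =>
      let p := march lam X f a b i in
      (snd p, snd p + half_step X j *
        ((snd p - fst p) / half_step X i
         + mid_step X j * (lam ^ 2 * snd p - f j)))
  end.

Lemma scheme_op_march (lam a b : R) (N : nat) (X f : nat -> R) (j : nat) :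
  increasing_grid N X -> (1 <= j <= N - 1)%nat ->
  scheme_op lam X (fun i => fst (march lam X f a b i)) j = f j.
Proof.
intros HX Hj.
pose proof (mid_step_pos N X j HX Hj) as Pm.
pose proof (HX (j - 1)%nat ltac:(lia)) as P1.
pose proof (HX j ltac:(lia)) as P2.
destruct j as [ | i]; [lia | ].
unfold scheme_op; rewrite Nat.add_1_r in *.
replace (S i - 1)%nat with i in * by lia.
simpl march; cbv zeta; simpl fst; simpl snd; field; lra.
Qed.

(** A particular solution [p] with the correct left value is corrected at the right end by a
    multiple of a homogeneous solution [v] vanishing at node 0. *)
Lemma scheme_solvable (lam mu0 mul : R) (N : nat) (X f : nat -> R) :
  0 < lam -> (2 <= N)%nat -> increasing_grid N X ->
  exists u, scheme_solution lam N X mu0 mul f u.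
Proof.
intros Hlam HN HX.
set (p := fun i => fst (march lam X f mu0 0 i)).
set (v := fun i => fst (march lam X (fun _ => 0) 0 1 i)).
(* If [v N] were 0, [v] would solve the problem with zero data and stability would force [v 1 = 0],
   whereas [v 1 = 1]. *)
assert (V : v N <> 0).
{ intros Z.
  assert (B : Rabs (v 1%nat) <= stability_constant lam * 0).
  { apply (scheme_stability lam 0 0 0 N X (fun _ => 0) v);
      rewrite ?Rabs_R0; auto; try lra; try lia.
    - split; [ | now split].
      intros j Hj; now apply (scheme_op_march lam 0 1 N X (fun _ => 0)).
    - intros; lra. }
  unfold v in B; simpl in B; rewrite Rabs_R1 in B; lra. }
exists (fun i => p i + (mul - p N) / v N * v i); split; [ | split].
- intros j Hj; rewrite scheme_op_plus_scal; unfold p, v.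
  rewrite !(scheme_op_march lam _ _ N) by easy; ring.
- unfold p, v; simpl; ring.
- field; easy.
Qed.

(** * Logarithm estimates and bounded remainders *)

(** Taylor polynomial of [ln (1 + y)] at 0. Degree 5 suffices: in the truncation error, the
    remainder of order 6 is always multiplied by a factor of order at least 1. *)
Definition ln_taylor (y : R) : R := y - y ^ 2 / 2 + y ^ 3 / 3 - y ^ 4 / 4 + y ^ 5 / 5.

(** The geometric sum makes the derivative of the difference exactly [- c ^ 5 / (1 + c)]; the mean
    value theorem then gives the bound, with 2 bounding [/ (1 + c)]. *)
Lemma ln_taylor_error (y : R) : Rabs y <= 1 / 2 ->
  Rabs (ln (1 + y) - ln_taylor y) <= 2 * Rabs y ^ 6.
Proof.
intros Hy.
set (g := fun y => ln (1 + y) - ln_taylor y).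
destruct (MVT_gen g 0 y (fun c => - c ^ 5 / (1 + c))) as [c [Hc E]].
- intros c Hc; unfold g, ln_taylor.
  assert (-1 < c).
  { apply Rabs_le_between in Hy; unfold Rmin in Hc; destruct Rle_dec; lra. }
  auto_derive; [lra | field; lra].
- intros c Hc; apply continuity_pt_filterlim, (ex_derive_continuous g c).
  assert (-1 < c).
  { apply Rabs_le_between in Hy; unfold Rmin in Hc; destruct Rle_dec; lra. }
  unfold g, ln_taylor; auto_derive; lra.
- replace (g 0) with 0 in E
    by (unfold g, ln_taylor; rewrite Rplus_0_r, ln_1; field).
  fold (g y); rewrite Rminus_0_r in E; rewrite E, Rminus_0_r, Rabs_mult.
  assert (Cy : Rabs c <= Rabs y).
  { revert Hc; unfold Rmin, Rmax, Rabs; repeat destruct Rle_dec;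
      repeat destruct Rcase_abs; lra. }
  assert (C1 : / (1 + c) <= 2).
  { replace 2 with (/ (1 / 2)) by field.
    apply Rinv_le_contravar; [lra | ].
    assert (Rabs c <= 1 / 2) as B by lra; apply Rabs_le_between in B; lra. }
  assert (C0 : 0 < / (1 + c)).
  { apply Rinv_0_lt_compat.
    assert (Rabs c <= 1 / 2) as B by lra; apply Rabs_le_between in B; lra. }
  unfold Rdiv; rewrite Rabs_mult, Rabs_Ropp, <- RPow_abs.
  rewrite (Rabs_right (/ (1 + c))) by lra.
  assert (D : Rabs c ^ 5 <= Rabs y ^ 5)
    by (apply pow_incr; split; [apply Rabs_pos | easy]).
  pose proof (pow_le (Rabs c) 5 (Rabs_pos c)).
  pose proof (Rabs_pos y).
  replace (2 * Rabs y ^ 6) with (Rabs y ^ 5 * 2 * Rabs y) by ring.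
  apply Rmult_le_compat_r; [easy | apply Rmult_le_compat; lra].
Qed.

Lemma ln_le_sub_1 (y : R) : 0 < y -> ln y <= y - 1.
Proof. intros Hy; pose proof (exp_ineq1_le (ln y)); rewrite exp_ln in *; lra. Qed.

Lemma ln_1_minus_le (t : R) : 0 < t <= 1 / 2 -> t <= - ln (1 - t).
Proof. intros Ht; pose proof (ln_le_sub_1 (1 - t)); lra. Qed.

(** Taking [ln y <= y - 1] at [y = / (1 + t)] gives [t / (1 + t) <= ln (1 + t)], and
    [1 + t <= 2]. *)
Lemma ln_1_plus_ge (t : R) : 0 < t <= 1 / 2 -> t / 2 <= ln (1 + t).
Proof.
intros Ht.
assert (P : 0 < / (1 + t)) by (apply Rinv_0_lt_compat; lra).
pose proof (ln_le_sub_1 _ P) as L; rewrite ln_Rinv in L by lra.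
assert (E : / (1 + t) * (1 + t) = 1) by (field; lra).
nra.
Qed.

(** Closure under ring operations gives the existence of a bound on a long expression without
    computing it. *)
Definition bounded_on (D : R -> Prop) (f : R -> R) : Prop :=
  exists K, forall t, D t -> Rabs (f t) <= K.

Lemma bounded_on_const (D : R -> Prop) (c : R) : bounded_on D (fun _ => c).
Proof. exists (Rabs c); intros; lra. Qed.

Lemma bounded_on_plus (D : R -> Prop) (f g : R -> R) :
  bounded_on D f -> bounded_on D g -> bounded_on D (fun t => f t + g t).
Proof.
intros [K HK] [L HL]; exists (K + L); intros t Ht.
pose proof (Rabs_triang (f t) (g t)); specialize (HK t Ht); specialize (HL t Ht); lra.
Qed.

Lemma bounded_on_mult (D : R -> Prop) (f g : R -> R) :
  bounded_on D f -> bounded_on D g -> bounded_on D (fun t => f t * g t).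
Proof.
intros [K HK] [L HL]; exists (K * L); intros t Ht.
rewrite Rabs_mult; apply Rmult_le_compat; auto using Rabs_pos.
Qed.

Lemma bounded_on_opp (D : R -> Prop) (f : R -> R) :
  bounded_on D f -> bounded_on D (fun t => - f t).
Proof.
intros [K HK]; exists K; intros t Ht; rewrite Rabs_Ropp; auto.
Qed.

Lemma bounded_on_pow (D : R -> Prop) (f : R -> R) (n : nat) :
  bounded_on D f -> bounded_on D (fun t => f t ^ n).
Proof.
intros Hf; induction n as [ | n IH]; simpl.
- apply bounded_on_const.
- now apply bounded_on_mult.
Qed.

(** Turns an O([t ^ n]) estimate into an exact expansion, [r] plus [t ^ n] times a bounded function,
    to which ring algebra applies. *)
Lemma bounded_on_remainder (D : R -> Prop) (f r : R -> R) (n : nat) (K : R) :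
  (forall t, D t -> 0 < t) ->
  (forall t, D t -> Rabs (f t - r t) <= K * t ^ n) ->
  bounded_on D (fun t => (f t - r t) / t ^ n).
Proof.
intros HD H; exists K; intros t Ht.
pose proof (pow_lt t n (HD t Ht)) as P.
unfold Rdiv; rewrite Rabs_mult, (Rabs_right (/ t ^ n))
  by (left; now apply Rinv_0_lt_compat).
apply Rmult_le_reg_r with (t ^ n); [easy | ].
rewrite Rmult_assoc, Rinv_l by lra; specialize (H t Ht); lra.
Qed.

(** * Truncation error on a logarithmic grid *)

(** The truncation error cleared of its logarithmic denominators: the fourth
    order comes from the cancellation of all its Taylor coefficients below
    [t ^ 7]. *)
Lemma truncation_numerator : exists K, forall t, 0 < t <= 1 / 2 ->
  Rabs (((1 + t) ^ 4 - 1) * - ln (1 - t) - (1 - (1 - t) ^ 4) * ln (1 + t)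
        - 8 * (ln (1 + t) + - ln (1 - t)) * ln (1 + t) * - ln (1 - t))
    <= K * t ^ 7.
Proof.
set (D := fun t : R => 0 < t <= 1 / 2).
set (e := fun t => (ln (1 + t) - ln_taylor t) / t ^ 6).
set (g := fun t => (- ln (1 - t) - - ln_taylor (- t)) / t ^ 6).
assert (He : bounded_on D e).
{ apply (bounded_on_remainder D (fun t => ln (1 + t)) ln_taylor 6 2);
    [unfold D; intros; lra | ].
  intros t [H0 H1]; pose proof (ln_taylor_error t) as B.
  rewrite (Rabs_right t) in B by lra; auto. }
assert (Hg : bounded_on D g).
{ apply (bounded_on_remainder D (fun t => - ln (1 - t))
           (fun t => - ln_taylor (- t)) 6 2); [unfold D; intros; lra | ].
  intros t [H0 H1]; pose proof (ln_taylor_error (- t)) as B.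
  rewrite (Rabs_Ropp t), (Rabs_right t) in B by lra.
  replace (- ln (1 - t) - - ln_taylor (- t))
    with (- (ln (1 + - t) - ln_taylor (- t))) by (unfold Rminus; ring).
  rewrite Rabs_Ropp; auto. }
(* Taylor polynomials divided by [t]: [ln (1 + t)] is [t * al t + e t * t ^ 6] and [- ln (1 - t)] is
   [t * be t + g t * t ^ 6]. *)
set (al := fun t => 1 + - (t * / 2) + t ^ 2 * / 3 + - (t ^ 3 * / 4) + t ^ 4 * / 5).
set (be := fun t => 1 + t * / 2 + t ^ 2 * / 3 + t ^ 3 * / 4 + t ^ 4 * / 5).
(* This is the numerator divided by [t ^ 7]: first what survives of its polynomial part, then the
   terms containing [e] and [g]. The closing [field] checks the identity. *)
assert (B : bounded_on D (fun t =>
  - (68 / 15) + - (467 / 135 * t ^ 2) + - (139 / 75 * t ^ 4)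
  + - (11 / 25 * t ^ 6) + - (16 / 125 * t ^ 8)
  + (4 + 6 * t + 4 * t ^ 2 + t ^ 3) * g t
  + - ((4 + - (6 * t) + 4 * t ^ 2 + - t ^ 3) * e t)
  + - (8 * t * ((e t + g t) * (al t + e t * t ^ 5) * (be t + g t * t ^ 5)
            + (al t + be t) * (e t * be t + g t * al t + e t * g t * t ^ 5))))).
{ unfold al, be.
  repeat first
    [ exact He | exact Hg | apply bounded_on_plus | apply bounded_on_opp
    | apply bounded_on_mult | apply bounded_on_const
    | apply bounded_on_pow
    | exists (1 / 2); unfold D; intros; rewrite Rabs_right; lra ]. }
destruct B as [K HK]; exists K; intros t Ht.
specialize (HK t Ht).
assert (P : 0 < t ^ 7) by (apply pow_lt; lra).
apply Rmult_le_compat_r with (r := t ^ 7) in HK; [ | lra].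
rewrite <- (Rabs_right (t ^ 7)) in HK at 1 by lra; rewrite <- Rabs_mult in HK.
eapply Rle_trans; [ | exact HK]; right; f_equal.
assert (E1 : ln (1 + t) = t * al t + e t * t ^ 6)
  by (unfold e, al, ln_taylor; field; lra).
assert (E2 : - ln (1 - t) = t * be t + g t * t ^ 6)
  by (unfold g, be, ln_taylor; field; lra).
rewrite E1, E2; unfold al, be; field.
Qed.

Lemma truncation_ratio : exists K, forall t, 0 < t <= 1 / 2 ->
  Rabs ((((1 + t) ^ 4 - 1) / ln (1 + t) - (1 - (1 - t) ^ 4) / - ln (1 - t))
        / (8 * (ln (1 + t) + - ln (1 - t))) - 1) <= K * t ^ 4.
Proof.
destruct truncation_numerator as [K HK]; exists (K / 4); intros t Ht.
specialize (HK t Ht).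
pose proof (ln_1_minus_le t Ht) as L1; pose proof (ln_1_plus_ge t Ht) as L2.
set (p := ln (1 + t)) in *; set (m := - ln (1 - t)) in *.
(* The common denominator is of order [t ^ 3], which turns the order 7 of the numerator into order
   4. *)
assert (Q : 4 * t ^ 3 <= 8 * (p + m) * p * m).
{ replace (4 * t ^ 3) with (8 * t * (t / 2) * t) by field.
  repeat (apply Rmult_le_compat; try nra). }
assert (P : 0 < t ^ 3) by (apply pow_lt; lra).
match type of HK with Rabs ?n <= _ =>
  replace ((_ / p - _ / m) / (8 * (p + m)) - 1) with (n / (8 * (p + m) * p * m))
    by (field; repeat split; lra) end.
unfold Rdiv; rewrite Rabs_mult, (Rabs_right (/ _))
  by (left; apply Rinv_0_lt_compat; lra).
apply Rle_trans with (K * t ^ 7 * / (4 * t ^ 3)); [ | right; field; lra].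
apply Rmult_le_compat; [apply Rabs_pos | left; apply Rinv_0_lt_compat; lra
  | exact HK | apply Rinv_le_contravar; lra].
Qed.

(** The steps depend on [t] alone and the nodal values are homogeneous of degree 4 in [s], so
    [s ^ 4] factors out. The 8 combines the 4 of each step size with the 1/2 of the mean step. *)
Lemma scheme_op_log_grid (lam s t : R) (X v : nat -> R) (j : nat) :
  0 < lam -> 0 < t <= 1 / 2 ->
  half_step X j = 4 / lam * ln (1 + t) ->
  half_step X (j - 1) = 4 / lam * - ln (1 - t) ->
  v j = s ^ 4 -> v (j + 1)%nat = (s * (1 + t)) ^ 4 ->
  v (j - 1)%nat = (s * (1 - t)) ^ 4 ->
  scheme_op lam X v j = - (lam ^ 2 * s ^ 4 *
    ((((1 + t) ^ 4 - 1) / ln (1 + t) - (1 - (1 - t) ^ 4) / - ln (1 - t))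
     / (8 * (ln (1 + t) + - ln (1 - t))) - 1)).
Proof.
intros Hlam Ht E1 E2 V0 V1 V2.
pose proof (ln_1_minus_le t Ht); pose proof (ln_1_plus_ge t Ht).
unfold scheme_op, mid_step; rewrite E1, E2, V0, V1, V2.
field; repeat split; lra.
Qed.

(** * The optimal grid and its truncation error *)

(** The optimal map sends [q] to [l + 4 / lam * ln s] with [s] affine in [q], so
    that the exact solution at the nodes is the fourth power of an arithmetic
    progression. *)
Definition node_factor (l lam : R) (N j : nat) : R :=
  exp (- (lam * l) / 4) + INR j * ((1 - exp (- (lam * l) / 4)) * mesh N).

Lemma exp_end_lt_1 (l lam : R) : 0 < l -> 0 < lam -> exp (- (lam * l) / 4) < 1.
Proof. intros Hl Hlam; rewrite <- exp_0; apply exp_increasing; nra. Qed.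

Lemma mesh_pos (N : nat) : (1 <= N)%nat -> 0 < mesh N.
Proof. intros HN; unfold mesh; apply Rdiv_lt_0_compat; [lra | apply lt_0_INR; lia]. Qed.

Lemma node_factor_ge (l lam : R) (N j : nat) : 0 < l -> 0 < lam -> (1 <= N)%nat ->
  exp (- (lam * l) / 4) <= node_factor l lam N j.
Proof.
intros Hl Hlam HN; unfold node_factor.
pose proof (exp_end_lt_1 l lam Hl Hlam); pose proof (mesh_pos N HN).
pose proof (pos_INR j).
assert (0 <= (1 - exp (- (lam * l) / 4)) * mesh N) by (apply Rmult_le_pos; lra).
nra.
Qed.

Lemma node_factor_S (l lam : R) (N j : nat) :
  node_factor l lam N (j + 1)
  = node_factor l lam N j + (1 - exp (- (lam * l) / 4)) * mesh N.
Proof. unfold node_factor; rewrite plus_INR; simpl; ring. Qed.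

Lemma image_gridE (l lam : R) (x : R -> R) (N j : nat) :
  0 < l -> 0 < lam -> optimal_map l lam x -> (1 <= N)%nat -> (j <= N)%nat ->
  image_grid x N j = l + 4 / lam * ln (node_factor l lam N j).
Proof.
intros Hl Hlam Hx HN Hj; unfold image_grid, node_factor, mesh.
assert (P : 0 < INR N) by (apply lt_0_INR; lia).
pose proof (pos_INR j); apply le_INR in Hj.
rewrite (proj1 (optimal_mapE l lam x Hl Hlam) Hx).
- unfold optimal_map_explicit; do 3 f_equal; field; lra.
- replace (INR j * (1 / INR N)) with (INR j / INR N) by (field; lra).
  split; [now apply Rle_mult_inv_pos | ].
  apply Rmult_le_reg_r with (INR N); [easy | ].
  unfold Rdiv; rewrite Rmult_assoc, Rinv_l by lra; lra.
Qed.

Lemma half_step_image_grid (l lam : R) (x : R -> R) (N j : nat) :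
  0 < l -> 0 < lam -> optimal_map l lam x -> (j < N)%nat ->
  half_step (image_grid x N) j
  = 4 / lam * (ln (node_factor l lam N (j + 1)) - ln (node_factor l lam N j)).
Proof.
intros Hl Hlam Hx Hj; unfold half_step.
rewrite !(image_gridE l lam) by (assumption || lia); ring.
Qed.

Lemma image_grid_increasing (l lam : R) (x : R -> R) (N : nat) :
  0 < l -> 0 < lam -> optimal_map l lam x -> increasing_grid N (image_grid x N).
Proof.
intros Hl Hlam Hx j Hj; rewrite (half_step_image_grid l lam) by easy.
pose proof (exp_pos (- (lam * l) / 4)); pose proof (exp_end_lt_1 l lam Hl Hlam).
pose proof (mesh_pos N ltac:(lia)).
pose proof (node_factor_ge l lam N j Hl Hlam ltac:(lia)).
apply Rmult_lt_0_compat; [apply Rdiv_lt_0_compat; lra | ].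
apply Rlt_0_minus, ln_increasing; [lra | ].
rewrite node_factor_S; nra.
Qed.

Lemma exact_sol_image_grid (l lam : R) (x : R -> R) (N j : nat) :
  0 < l -> 0 < lam -> optimal_map l lam x -> (1 <= N)%nat -> (j <= N)%nat ->
  exact_sol l lam (image_grid x N j) = node_factor l lam N j ^ 4.
Proof.
intros Hl Hlam Hx HN Hj; unfold exact_sol.
rewrite (image_gridE l lam) by easy.
pose proof (exp_pos (- (lam * l) / 4)).
pose proof (node_factor_ge l lam N j Hl Hlam HN).
replace (lam * (l + 4 / lam * ln (node_factor l lam N j) - l))
  with (INR 4 * ln (node_factor l lam N j)) by (simpl; field; lra).
change (exp (INR 4 * ln ?s)) with (Rpower s (INR 4)).
apply Rpower_pow; lra.
Qed.

Lemma truncation_error (l lam : R) (x : R -> R) :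
  0 < l -> 0 < lam -> optimal_map l lam x ->
  exists (K : R) (N0 : nat), 0 <= K /\ forall N j : nat,
    (N0 <= N)%nat -> (1 <= j <= N - 1)%nat ->
    Rabs (scheme_op lam (image_grid x N)
            (fun i => exact_sol l lam (image_grid x N i)) j) <= K * mesh N ^ 4.
Proof.
intros Hl Hlam Hx; destruct truncation_ratio as [K HK].
pose proof (exp_pos (- (lam * l) / 4)) as P0.
pose proof (exp_end_lt_1 l lam Hl Hlam) as L0.
pose proof (pow_lt lam 2 Hlam) as Pl.
set (s0 := exp (- (lam * l) / 4)) in *.
(* Since [s0] is a lower bound of all node factors, [mesh N <= s0 / 2] keeps the relative increment
   [t] at most 1/2 at every interior node. *)
destruct (INR_unbounded (2 / s0)) as [N0 HN0].
exists (lam ^ 2 * Rabs K), N0; split.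
{ pose proof (Rabs_pos K); nra. }
intros N j HN Hj.
pose proof (mesh_pos N ltac:(lia)) as Pm.
set (d := (1 - s0) * mesh N).
assert (Pd : 0 < d) by (apply Rmult_lt_0_compat; lra).
assert (Ld : d <= mesh N) by (unfold d; nra).
assert (Lm : mesh N <= s0 / 2).
{ apply le_INR in HN; unfold mesh.
  assert (0 < 2 / s0) by (apply Rdiv_lt_0_compat; lra).
  replace (s0 / 2) with (/ (2 / s0)) by (field; lra).
  unfold Rdiv at 1; rewrite Rmult_1_l; apply Rinv_le_contravar; lra. }
pose proof (node_factor_ge l lam N j Hl Hlam ltac:(lia)) as Ps; fold s0 in Ps.
pose proof (node_factor_S l lam N j) as S1.
pose proof (node_factor_S l lam N (j - 1)) as S2.
replace (j - 1 + 1)%nat with j in S2 by lia.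
fold s0 in S1, S2; fold d in S1, S2.
set (s := node_factor l lam N j) in *.
set (t := d / s).
assert (Et : s * t = d) by (unfold t; field; lra).
assert (Ht : 0 < t <= 1 / 2).
{ split; [apply Rdiv_lt_0_compat; lra | ].
  apply Rmult_le_reg_l with s; [lra | nra]. }
assert (F1 : node_factor l lam N (j + 1) = s * (1 + t)) by (rewrite S1; lra).
assert (F2 : node_factor l lam N (j - 1) = s * (1 - t)) by lra.
rewrite (scheme_op_log_grid lam s t); try easy.
- specialize (HK t Ht).
  assert (P4 : 0 < s ^ 4) by (apply pow_lt; lra).
  rewrite Rabs_Ropp, Rabs_mult, (Rabs_right (lam ^ 2 * s ^ 4)) by nra.
  apply Rle_trans with (lam ^ 2 * s ^ 4 * (Rabs K * t ^ 4)).
  + apply Rmult_le_compat_l; [nra | ].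
    eapply Rle_trans; [exact HK | ].
    apply Rmult_le_compat_r; [apply pow_le; lra | apply Rle_abs].
  (* The weight [s ^ 4] cancels the denominator of [t ^ 4], leaving [d ^ 4]: this makes the bound
     uniform in [j]. *)
  + replace (lam ^ 2 * s ^ 4 * (Rabs K * t ^ 4))
      with (lam ^ 2 * Rabs K * (s * t) ^ 4) by ring.
    rewrite Et; apply Rmult_le_compat_l; [pose proof (Rabs_pos K); nra | ].
    apply pow_incr; lra.
- rewrite (half_step_image_grid l lam) by (assumption || lia).
  fold s; rewrite F1, ln_mult by lra; ring.
- rewrite (half_step_image_grid l lam) by (assumption || lia).
  replace (j - 1 + 1)%nat with j by lia.
  fold s; rewrite F2, ln_mult by lra; ring.
- apply (exact_sol_image_grid l lam); (assumption || lia).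
- rewrite <- F1; apply (exact_sol_image_grid l lam); (assumption || lia).
- rewrite <- F2; apply (exact_sol_image_grid l lam); (assumption || lia).
Qed.

(** * Stability and fourth-order convergence *)

Theorem theorem1 (l lam : R) (hl : 0 < l) (hlam : 0 < lam)
    (x : R -> R) (hx : optimal_map l lam x) :
  stable lam (image_grid x) /\
  exists (C : R) (N0 : nat), forall N : nat, (2 <= N)%nat -> (N0 <= N)%nat ->
    (exists u : nat -> R, optimal_scheme_solution l lam x N u) /\
    (forall u : nat -> R, optimal_scheme_solution l lam x N u ->
       max_abs (fun j => u j - exact_sol l lam (image_grid x N j)) 0 (N + 1)
         <= C * mesh N ^ 4).
Proof.
pose proof (fun N => image_grid_increasing l lam x N hl hlam hx) as HX.
split; [now apply stable_of_increasing | ].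
destruct (truncation_error l lam x hl hlam hx) as [K [N0 [PK HK]]].
exists (stability_constant lam * K), N0; intros N HN HN0.
split; [now apply scheme_solvable | ].
intros u [Hu [U0 UN]].
destruct (exact_sol_bvp l lam) as [_ [B0 B1]].
assert (M : 0 <= K * mesh N ^ 4).
{ apply Rmult_le_pos; [easy | apply pow_le; left; apply mesh_pos; lia]. }
assert (G0 : image_grid x N 0 = 0).
{ unfold image_grid; simpl; rewrite Rmult_0_l; apply (optimal_map_0 _ _ _ hx). }
assert (GN : image_grid x N N = l).
{ unfold image_grid, mesh; replace (INR N * (1 / INR N)) with 1; [apply (optimal_map_1 _ _ _ hx) | ].
  field; apply not_0_INR; lia. }
apply max_abs_le; [lia | intros j Hj; rewrite Rmult_assoc].
(* The error solves the scheme with zero boundary values and with minus the truncation error as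
   source. *)
apply (scheme_stability lam (K * mesh N ^ 4) 0 0 N (image_grid x N)
  (fun j => - scheme_op lam (image_grid x N)
              (fun i => exact_sol l lam (image_grid x N i)) j)
  (fun j => u j - exact_sol l lam (image_grid x N j)));
  rewrite ?Rabs_R0; auto; try lia.
- split; [ | split].
  + intros i Hi; rewrite scheme_op_minus, Hu by easy; ring.
  + rewrite U0, G0, B0; ring.
  + rewrite UN, GN, B1; ring.
- intros i Hi; rewrite Rabs_Ropp; now apply HK.
Qed.
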